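(* Let $\mathcal{G}=\{\mathcal{V},\mathcal{E}\}$ be a finite simple undirected connected graph with $\mathcal{V}=\{1,\dots,n\}$, let $m\ge 1$ and $\sigma>0$, and let $\mathcal{C}\subset\mathcal{V}$ be a set of corrupted agents, with $\mathcal{H}=\mathcal{V}\setminus\mathcal{C}$. If $\mathcal{C}$ is not a vertex cut of $\mathcal{G}$, then the distributed optimization protocol described in the context is $(\mathcal{C},\epsilon)$-affine private with $$\epsilon=\frac{1}{4\sigma^2\,\underline{\mu}(\mathcal{L}_{\mathcal{H}})},$$ where $\mathcal{L}_{\mathcal{H}}$ is the graph Laplacian of the subgraph $\mathcal{G}_{\mathcal{H}}$ of $\mathcal{G}$ induced by $\mathcal{H}$ and $\underline{\mu}(\mathcal{L}_{\mathcal{H}})$ is its smallest non-zero eigenvalue. That is, for all $\alpha=(\alpha_i)_{i\in\mathcal{V}}$ and $\alpha'=(\alpha'_i)_{i\in\mathcal{V}}$ in $(\mathbb{R}^m)^n$ with $\alpha_i=\alpha'_i$ for all $i\in\mathcal{C}$ and $\sum_{i\in\mathcal{H}}\alpha_i=\sum_{i\in\mathcal{H}}\alpha'_i$, $$D_{KL}\big(\mathrm{View}_{\mathcal{C}}(\alpha),\mathrm{View}_{\mathcal{C}}(\alpha')\big)\le \epsilon\,\mathrm{dist}(\alpha,\alpha')^2 .$$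
   Context: Graph notions. $\mathcal{N}_i$ is the set of neighbors of node $i$. A graph is connected if every two distinct nodes are joined by a path (a single-node graph is connected). A set $S\subset\mathcal{V}$ is a vertex cut of $\mathcal{G}$ if removing the nodes of $S$ and all edges incident to them leaves a graph that is not connected. The incidence matrix $\nabla$ of a graph has rows indexed by nodes and columns by edges, with $\nabla_{i,e}=1$ if $e=\{i,j\}$ and $i<j$, $\nabla_{i,e}=-1$ if $e=\{i,j\}$ and $i>j$, and $0$ otherwise; the graph Laplacian is $\mathcal{L}=\nabla\nabla^T$. Costs. Each agent $i\in\mathcal{V}$ holds a private cost $h_i:\mathbb{R}^m\to\mathbb{R}$, $h_i(x)=h_i^{(na)}(x)+\alpha_i^Tx$, where $\alpha_i\in\mathbb{R}^m$ is its affine coefficient and $h_i^{(na)}$ is the non-affine part. The non-affine parts are fixed (non-random, the same for $\alpha$ and $\alpha'$), so a cost is represented by its affine coefficient. Protocol. First phase: for every ordered pair $(i,j)$ with $\{i,j\}\in\mathcal{E}$, agent $i$ draws $r_{ij}\sim N(0_m,\sigma^2 I_m)$, all draws being mutually independent, and sends $r_{ij}$ to agent $j$. Agent $i$ computes the mask $a_i=\sum_{j\in\mathcal{N}_i}(r_{ji}-r_{ij})\in\mathbb{R}^m$ and the effective cost $\widetilde h_i(x)=h_i(x)+a_i^Tx$, whose affine coefficient is $\widetilde\alpha_i=\alpha_i+a_i$. Second phase: the agents run an arbitrary distributed optimization algorithm on the effective costs. In the worst case this reveals all effective costs to everyone, and the view is defined accordingly. View. $\mathrm{View}_{\mathcal{C}}(\alpha)$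 is the random variable consisting of the affine coefficients $(\alpha_i)_{i\in\mathcal{C}}$ of the corrupted agents, all values $r_{ij}$ sent or received by corrupted agents (i.e. $r_{ij}$ and $r_{ji}$ for every edge $\{i,j\}$ incident to $\mathcal{C}$), and all effective affine coefficients $(\widetilde\alpha_i)_{i\in\mathcal{V}}$, when the agents' affine coefficients are $\alpha$. Privacy. For random variables (identified with their laws $P,Q$), $D_{KL}(P,Q)=\int\log\frac{dP}{dQ}\,dP$ is the Kullback–Leibler divergence (natural logarithm), equal to $+\infty$ if $P\not\ll Q$. The distance is $\mathrm{dist}(\alpha,\alpha')=\sqrt{\sum_{k=1}^m\|\alpha^k-\alpha'^k\|^2}$, where $\alpha^k=[\alpha_1^k,\dots,\alpha_n^k]^T$ is the vector of $k$-th coordinates and $\|\cdot\|$ is the Euclidean norm. For $\epsilon>0$, the protocol is $(\mathcal{C},\epsilon)$-affine private if for all $\alpha,\alpha'$ with $\alpha_i=\alpha_i'$ for $i\in\mathcal{C}$ and $\sum_{i\in\mathcal{H}}\alpha_i=\sum_{i\in\mathcal{H}}\alpha'_i$ one has $D_{KL}(\mathrm{View}_{\mathcal{C}}(\alpha),\mathrm{View}_{\mathcal{C}}(\alpha'))\le\epsilon\,\mathrm{dist}(\alpha,\alpha')^2$. Convention: if $|\mathcal{H}|\le 1$, then $\mathcal{L}_{\mathcal{H}}$ has no non-zero eigenvalue and $\epsilon$ is understood to be an arbitrary positive number (in this case the privacy condition is vacuous). *)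

(* Defs.v *)
(* MathComp / MathComp-Analysis *)
From HB Require Import structures.
From mathcomp Require Import all_boot all_order all_algebra.
From mathcomp Require Import all_classical all_reals all_analysis.
From mathcomp Require Import measurable_realfun charge.

Set Implicit Arguments.
Unset Strict Implicit.
Unset Printing Implicit Defensive.

Import Order.TTheory GRing.Theory Num.Theory.
Import numFieldNormedType.Exports.

Local Open Scope classical_set_scope.
Local Open Scope ring_scope.
Local Open Scope charge_scope.

(* A simple undirected graph on {0, ..., n-1} is its adjacency relation
   e : rel 'I_n, assumed symmetric and irreflexive. *)
Section Graphs.
Variable n : nat.
Implicit Types (e : rel 'I_n) (S : {set 'I_n}).

Definition graph_connected e : Prop :=
  forall i j : 'I_n, i != j -> connect e i j.

(* The nodes of S are renumbered by enum_val : 'I_#|S| -> 'I_n, which is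
   increasing, so that the orientation of the edges is preserved. *)
Definition induced_graph e S : rel 'I_#|S| :=
  fun a b => e (enum_val a) (enum_val b).

(* The edge {i, j} with i < j is represented by the pair (i, j). *)
Definition edges e : {set 'I_n * 'I_n} :=
  [set p : 'I_n * 'I_n | (p.1 < p.2)%N && e p.1 p.2]%SET.

Definition incidence_mx (R : pzRingType) e : 'M[R]_(n, #|edges e|) :=
  \matrix_(i, c) (let p := enum_val c in
                  if i == p.1 then 1 else if i == p.2 then -1 else 0).

Definition laplacian (R : pzRingType) e : 'M[R]_n :=
  incidence_mx R e *m (incidence_mx R e)^T.

End Graphs.

Arguments induced_graph {n} e S.

Definition vertex_cut (n : nat) (e : rel 'I_n) (S : {set 'I_n}) : Prop :=
  ~ graph_connected (induced_graph e (~: S)%SET).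

(* Junk value 0 when A has no smallest non-zero eigenvalue. *)
Definition smallest_nonzero_eigenvalue (R : realType) (n : nat) (A : 'M[R]_n)
    : R :=
  xget 0 [set mu : R | [/\ eigenvalue A mu, mu != 0 &
    forall nu : R, eigenvalue A nu -> nu != 0 -> mu <= nu]].

(* R^m is 'rV[R]_m with the product (Borel) sigma-algebra, i.e. the one
   generated by the coordinates. *)
Definition row_display : measure_display -> measure_display.
Proof. exact. Qed.

Section MeasurableRow.
Context {d : measure_display} {T : measurableType d} (m : nat).

Let coord (k : 'I_m) (v : 'rV[T]_m) : T := v ord0 k.

Let row_set0 : g_sigma_preimage coord set0.
Proof. exact: sigma_algebra0. Qed.

Let row_setC A : g_sigma_preimage coord A -> g_sigma_preimage coord (~` A).
Proof. exact: sigma_algebraC. Qed.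

Let row_bigcup (F : (set 'rV[T]_m)^nat) :
  (forall i, g_sigma_preimage coord (F i)) ->
  g_sigma_preimage coord (\bigcup_i F i).
Proof. exact: sigma_algebra_bigcup. Qed.

HB.instance Definition _ := @isMeasurable.Build (row_display d)
  'rV[T]_m (g_sigma_preimage coord) row_set0 row_setC row_bigcup.

End MeasurableRow.

Section Probability.
Local Open Scope ereal_scope.

Lemma measurable_coord d (T : measurableType d) (m : nat) (k : 'I_m) :
  measurable_fun [set: 'rV[T]_m] (fun v : 'rV[T]_m => v ord0 k).
Proof.
move=> _ Y mY; rewrite setTI; apply: sub_sigma_algebra => /=.
rewrite -bigcup_seq/=; exists k => /=; first by rewrite mem_index_enum.
by exists Y => //; rewrite setTI.
Qed.

Arguments measurable_coord {d T m} k.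

Lemma measurable_fun_rowP d d' (T : measurableType d) (T' : measurableType d')
    (m : nat) (f : T -> 'rV[T']_m) :
  measurable_fun [set: T] f <->
  forall k, measurable_fun [set: T] (fun x => f x ord0 k).
Proof.
split=> [mf k|mf].
  exact: (measurableT_comp (measurable_coord k) mf).
move=> _ A mA; rewrite setTI.
suff : g_sigma_preimage (fun (k : 'I_m) (v : 'rV[T']_m) => v ord0 k) `<=`
       [set B | measurable (f @^-1` B)] by exact.
apply: smallest_sub.
  split=> /= [|B mB|F mF].
  - by rewrite preimage_set0.
  - by rewrite setTD preimage_setC; exact: measurableC.
  - by rewrite preimage_bigcup; exact: bigcup_measurable.
rewrite -bigcup_seq/= => B [k _ [Y mY <-]] /=.
by rewrite setTI; have := mf k measurableT Y mY; rewrite setTI.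
Qed.

Definition kl_divergence d (T : measurableType d) (R : realType)
    (P Q : probability T R) : \bar R :=
  if `[< P `<< Q >] then
    \int[P]_x lne (('d (charge_of_finite_measure P) '/d Q) x)
  else +oo.

(* Mutual independence of the subfamily (X i), i in D. *)
Definition mutually_independent d d' (T : measurableType d)
    (T' : measurableType d') (R : realType) (P : probability T R)
    (I : finType) (D : {set I}) (X : I -> T -> T') : Prop :=
  forall (J : {set I}) (B : I -> set T'), J \subset D ->
    (forall i, i \in J -> measurable (B i)) ->
    P [set w | forall i, i \in J -> B i (X i w)] =
    \prod_(i in J) P (X i @^-1` B i).

(* X ~ N(0_m, sigma^2 I_m): the coordinates are independent and have law
   N(0, sigma^2).  The second parameter of normal_prob is the standard
   deviation. *)
Definition isotropic_gaussian d (T : measurableType d) (R : realType)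
    (P : probability T R) (m : nat) (sigma : R) (X : T -> 'rV[R]_m) : Prop :=
  (forall (k : 'I_m) (B : set R), measurable B ->
     P ((fun w => X w ord0 k) @^-1` B) = normal_prob 0 sigma B) /\
  mutually_independent P [set: 'I_m]%SET (fun k w => X w ord0 k).

End Probability.

Section Protocol.
Context {R : realType} {d : measure_display} {Omega : measurableType d}.
Variables (P : probability Omega R) (n m : nat) (e : rel 'I_n).
(* r i j is the vector drawn by i and sent to j; the values at pairs (i, j)
   that are not adjacent are never used. *)
Variable r : 'I_n -> 'I_n -> {RV P >-> 'rV[R]_m}.
Implicit Types (alpha : 'I_n -> 'rV[R]_m) (C : {set 'I_n}).

Definition arcs : {set 'I_n * 'I_n} :=
  [set p : 'I_n * 'I_n | e p.1 p.2]%SET.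

Definition protocol_draws (sigma : R) : Prop :=
  (forall i j, e i j -> isotropic_gaussian P sigma (r i j)) /\
  mutually_independent P arcs (fun p => r p.1 p.2 : Omega -> 'rV[R]_m).

Definition mask (i : 'I_n) (w : Omega) : 'rV[R]_m :=
  \sum_(j | e i j) (r j i w - r i j w).

Definition effective_coef alpha (i : 'I_n) (w : Omega) : 'rV[R]_m :=
  alpha i + mask i w.

Definition observed_arcs C : {set 'I_n * 'I_n} :=
  [set p in arcs | (p.1 \in C) || (p.2 \in C)]%SET.

Definition view C alpha (w : Omega) :
    #|C|.-tuple 'rV[R]_m * #|observed_arcs C|.-tuple 'rV[R]_m *
    n.-tuple 'rV[R]_m :=
  ([tuple alpha (enum_val c) | c < #|C|],
   [tuple r (enum_val c).1 (enum_val c).2 w | c < #|observed_arcs C|],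
   [tuple effective_coef alpha i w | i < n]).

Let measurable_view C alpha : measurable_fun [set: Omega] (view C alpha).
Proof.
apply: measurable_fun_pair; first apply: measurable_fun_pair.
- exact: measurable_cst.
- apply/measurable_fun_tnthP => c.
  rewrite (_ : _ \o _ = r (enum_val c).1 (enum_val c).2) //.
  by apply/funext => w /=; rewrite tnth_mktuple.
- apply/measurable_fun_tnthP => i.
  rewrite (_ : _ \o _ = effective_coef alpha i); last first.
    by apply/funext => w /=; rewrite tnth_mktuple.
  apply/measurable_fun_rowP => k.
  rewrite (_ : (fun w => _) = (fun w => alpha i ord0 k +
      \sum_(j <- enum 'I_n | e i j) (r j i w ord0 k - r i j w ord0 k)));
    last first.
    apply/funext => w; rewrite /effective_coef /mask mxE summxE big_enum_cond.
    by congr (_ + _); apply: eq_bigr => j _; rewrite !mxE.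
  apply: measurable_funD => //.
  rewrite (_ : (fun w => _) = (fun w => \sum_(j <- [seq j <- enum 'I_n | e i j])
      (r j i w ord0 k - r i j w ord0 k))); last first.
    by apply/funext => w; rewrite big_filter.
  apply: measurable_sum => j.
  by apply: measurable_funB;
    apply: (measurableT_comp (measurable_coord k)).
Qed.

HB.instance Definition _ C alpha :=
  isMeasurableFun.Build _ _ _ _ (view C alpha) (@measurable_view C alpha).

End Protocol.

(* The library norm on matrices is the sup norm. *)
Definition euclidean_norm (R : realType) (n : nat) (v : 'cV[R]_n) : R :=
  Num.sqrt (\sum_(i < n) v i ord0 ^+ 2).

Definition affine_dist (R : realType) (n m : nat)
    (alpha alpha' : 'I_n -> 'rV[R]_m) : R :=
  let coords (a : 'I_n -> 'rV[R]_m) (k : 'I_m) := \col_(i < n) a i ord0 k in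
  Num.sqrt (\sum_(k < m)
    euclidean_norm (coords alpha k - coords alpha' k) ^+ 2).

Definition affine_private (R : realType) (d : measure_display)
    (Omega : measurableType d) (P : probability Omega R) (n m : nat)
    (e : rel 'I_n) (r : 'I_n -> 'I_n -> {RV P >-> 'rV[R]_m})
    (C : {set 'I_n}) (eps : R) : Prop :=
  0 < eps /\
  forall alpha alpha' : 'I_n -> 'rV[R]_m,
    (forall i, i \in C -> alpha i = alpha' i) ->
    \sum_(i in (~: C)%SET) alpha i = \sum_(i in (~: C)%SET) alpha' i ->
    (kl_divergence (distribution P (view e r C alpha))
                   (distribution P (view e r C alpha'))
     <= (eps * affine_dist alpha alpha' ^+ 2)%:E)%E.

(* Main.v *)
Require Import Defs.
From HB Require Import structures.
From mathcomp Require Import all_boot all_order all_algebra.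
From mathcomp Require Import all_classical all_reals all_analysis.
From mathcomp Require Import measurable_realfun ring lra.

(* Moving alpha to alpha' can be compensated by translating the Gaussian draws
   exchanged between honest agents: if u L_H = alpha - alpha' on H, then
   adding (u_j - u_i) / 2 to each r_ij changes the masks by alpha - alpha', so
   View(alpha)(r) = View(alpha')(r + s) for the resulting translation s.
   By the Gaussian translation formula the law of r + s under the weight
   Z = exp(- <s, r> / sigma^2 - |s|^2 / (2 sigma^2)) is the law of r, so the
   inequality ln x <= x - 1, applied to x = f Z with f the density of
   View(alpha) with respect to View(alpha'), bounds the divergence by
   |s|^2 / (2 sigma^2).  Finally |s|^2 = u L_H u^T / 2, summed over the
   coordinates, and u L_H u^T <= |u L_H|^2 / mu by the variational
   characterization of the smallest non-zero eigenvalue mu. *)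

Set Implicit Arguments.
Unset Strict Implicit.
Unset Printing Implicit Defensive.

Import Order.TTheory GRing.Theory Num.Theory.
Import numFieldNormedType.Exports.

Local Open Scope classical_set_scope.
Local Open Scope ring_scope.

(** * Integration against weighted laws *)

Section WeightedLaw.
Local Open Scope ereal_scope.
Context d d' (T : measurableType d) (T' : measurableType d') (R : realType).
Variables (mu : {measure set T -> \bar R}) (g : T -> R) (X : T -> T').
Hypotheses (mg : measurable_fun setT g) (g0 : forall x, (0 <= g x)%R).
Hypothesis mX : measurable_fun setT X.

Import HBNNSimple.

(** Both sides are limits of integrals of the same increasing simple functions, and on indicators
    the equality is the hypothesis on [nu]. Besides tilts, this serves for laws given by a density,
    with [X] the identity. *)
Lemma ge0_integral_weighted_law (nu : {measure set T' -> \bar R})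
    (f : T' -> \bar R) :
    (forall A, measurable A -> nu A = \int[mu]_(x in X @^-1` A) (g x)%:E) ->
    measurable_fun setT f -> (forall y, 0 <= f y) ->
  \int[nu]_y f y = \int[mu]_x (f (X x) * (g x)%:E).
Proof.
move=> nuE mf f0; pose h := nnsfun_approx measurableT mf.
have mgE : measurable_fun setT (EFin \o g) by exact/measurable_EFinP.
have -> : \int[nu]_y f y = lim (\int[nu]_y (h n y)%:E @[n --> \oo]).
  rewrite -monotone_convergence//.
  - apply: eq_integral => y _; apply/esym/cvg_lim => //.
    exact: cvg_nnsfun_approx.
  - by move=> n; exact/measurable_EFinP/measurable_funP.
  - by move=> n x _ /=; rewrite lee_fin.
  - by move=> x _ a b ab; rewrite lee_fin; exact/lefP/nd_nnsfun_approx.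
have -> : \int[mu]_x (f (X x) * (g x)%:E) =
    lim (\int[mu]_x ((h n (X x))%:E * (g x)%:E) @[n --> \oo]).
  rewrite -monotone_convergence//.
  - apply: eq_integral => x _; apply/esym/cvg_lim => //; apply: cvgeZr => //.
    exact: cvg_nnsfun_approx.
  - move=> n; apply/emeasurable_funM => //; apply/measurable_EFinP.
    exact: measurableT_comp.
  - by move=> n x _ /=; rewrite mule_ge0 ?lee_fin.
  - move=> x _ a b ab; rewrite lee_wpmul2r ?lee_fin//.
    exact/lefP/nd_nnsfun_approx.
apply/congr_lim/funext => n.
transitivity (\int[nu]_y
   (\sum_(r \in range (h n)) (r * \1_(h n @^-1` [set r]) y)%:E)).
  by apply: eq_integral => t _; rewrite /= fimfunE -fsumEFin.
rewrite ge0_integral_fsum//; first last.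
- by move=> m y _; exact: nnfun_muleindic_ge0.
- by move=> r; apply/measurable_EFinP; exact: measurable_funM.
transitivity (\int[mu]_x (\sum_(r \in range (h n))
    (r * \1_(h n @^-1` [set r]) (X x))%:E * (g x)%:E)); last first.
  apply: eq_integral => x _; rewrite -ge0_mule_fsuml => [|r]; last first.
    exact: nnfun_muleindic_ge0.
  by rewrite fsumEFin // -(fimfunE _ (X x)).
have mind r : measurable_fun setT
    (fun x => (r * \1_(h n @^-1` [set r]) (X x))%:E).
  apply/measurable_EFinP; apply: measurable_funM => //.
  exact: (measurableT_comp _ mX).
rewrite ge0_integral_fsum//; first last.
- by move=> r x _; rewrite mule_ge0 ?lee_fin//; exact: nnfun_muleindic_ge0.
- by move=> r; exact: emeasurable_funM.
apply: eq_fsbigr => r rhn.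
have r0 : (0 <= r)%R by move: rhn; rewrite inE => -[t _ <-].
have mB : measurable (X @^-1` (h n @^-1` [set r])).
  by rewrite -[X in measurable X]setTI; exact: mX.
under [LHS]eq_integral do rewrite EFinM.
rewrite integralZl_indic_nnsfun// integral_indic// setIT nuE//.
under [RHS]eq_integral do rewrite EFinM -muleA.
rewrite ge0_integralZl//.
- congr (_ * _); rewrite [LHS]integral_mkcond; apply: eq_integral => x _.
  by rewrite muleC epatch_indic.
- apply: emeasurable_funM => //; apply/measurable_EFinP.
  exact: (measurableT_comp _ mX).
- by move=> x _; rewrite mule_ge0 ?lee_fin.
Qed.

(** The proofs are arguments so that the measure structure can be attached to the set function
    itself. *)
Definition weighted_law of measurable_fun setT g & (forall x, (0 <= g x)%R) &
  measurable_fun setT X := fun A => \int[mu]_(x in X @^-1` A) (g x)%:E.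

Let nu := weighted_law mg g0 mX.

Let nu0 : nu set0 = 0.
Proof. by rewrite /nu /weighted_law preimage_set0 integral_set0. Qed.

Let nu_ge0 A : 0 <= nu A.
Proof. by apply: integral_ge0 => x _; rewrite lee_fin. Qed.

Let nu_additive : semi_sigma_additive nu.
Proof.
move=> F mF tF mUF; rewrite /nu /weighted_law preimage_bigcup.
have mXF i : measurable (X @^-1` F i).
  by rewrite -[X in measurable X]setTI; exact: mX.
apply: (@semi_sigma_additive_nng_induced _ _ _ mu (EFin \o g)) => //.
- exact/measurable_EFinP.
- apply/trivIsetP => i j _ _ ij; move/trivIsetP : tF => tF.
  by rewrite -preimage_setI tF// preimage_set0.
- exact: bigcup_measurable.
Qed.

HB.instance Definition _ :=
  isMeasure.Build _ _ _ (weighted_law mg g0 mX) nu0 nu_ge0 nu_additive.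

End WeightedLaw.

(* The functions f k are taken out of the class of indicators one at a time. *)
Lemma mutually_independent_integral_prod d d' (T : measurableType d)
    (T' : measurableType d') (R : realType) (P : probability T R) (K : finType)
    (X : K -> {RV P >-> T'}) (f : K -> T' -> R) :
    mutually_independent P [set: K]%SET (fun k => X k : T -> T') ->
    (forall k, measurable_fun setT (f k)) -> (forall k y, 0 <= f k y) ->
    (forall k, \int[P]_x (f k (X k x))%:E < +oo)%E ->
  (\int[P]_x (\prod_k f k (X k x))%:E = \prod_k \int[P]_x (f k (X k x))%:E)%E.
Proof.
move=> indX.
suff main (s : seq K) : forall f : K -> T' -> R,
    (forall k, measurable_fun setT (f k)) -> (forall k y, 0 <= f k y) ->
    (forall k, \int[P]_x (f k (X k x))%:E < +oo)%E ->
    (forall k, k \notin s -> exists2 B, measurable B & f k = \1_B) ->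
    (\int[P]_x (\prod_k f k (X k x))%:E =
     \prod_k \int[P]_x (f k (X k x))%:E)%E.
  by move=> mf f0 foo; apply: (main (enum K)) => // k; rewrite mem_enum.
have mXB k B : measurable B -> measurable (X k @^-1` B).
  by move=> mB; rewrite -[X in measurable X]setTI; exact: measurable_funP.
elim: s => [|j s IH] {}f mf f0 foo fs.
  (* With indicators only, the claim is mutual independence itself. *)
  have /choice[B fB] : forall k, exists B, measurable B /\ f k = \1_B.
    by move=> k; have [//|B mB ->] := fs k; exists B.
  have mB k : measurable (B k) by have [] := fB k.
  have fE k : f k = \1_(B k) by have [] := fB k.
  under [RHS]eq_bigr => k _.
    rewrite fE (_ : (fun x => _) =
      (fun x => (\1_(X k @^-1` B k) x)%:E)); last by [].
    rewrite integral_indic//; last exact: mXB.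
    rewrite setIT; over.
  have := indX [set: K]%SET B (subxx _) (fun k _ => mB k).
  rewrite [X in _ = X -> _](eq_bigl xpredT) => [<-|k]; last by rewrite inE.
  set E := [set w | _].
  have -> : E = \bigcap_(k in [set: K]) (X k @^-1` B k).
    by apply/seteqP; split=> x /= + k; [move=> + _; apply|move=> + _; apply].
  rewrite -[in RHS](setIT (\bigcap_(_ in _) _)) -integral_indic//; last first.
    by apply: fin_bigcap_measurable => // k _; exact: mXB.
  apply: eq_integral => x _; congr EFin; rewrite !indicE.
  case: (boolP (_ \in _)) => [|/negP xE].
    rewrite inE => xE; rewrite big1// => k _.
    by rewrite fE indicE mem_set//; exact: xE.
  have [k xk] : exists k, ~ B k (X k x).
    apply: contrapT => /forallNP xB; apply: xE; rewrite inE => k _.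
    by apply: contrapT => /xB.
  by rewrite (bigD1 k)//= fE indicE memNset// mul0r.
have [js|js] := boolP (j \in s).
  apply: IH => // k ks; apply: fs; rewrite inE negb_or ks andbT.
  by apply: contraNneq ks => ->.
pose c := (\prod_(k | k != j) \int[P]_x (f k (X k x))%:E)%E.
have cfin k : (\int[P]_x (f k (X k x))%:E)%E \is a fin_num.
  by rewrite ge0_fin_numE// integral_ge0// => x _; rewrite lee_fin.
have c0 : (0 <= c)%E.
  by apply: prode_ge0 => k _; apply: integral_ge0 => x _; rewrite lee_fin.
have cf : c \is a fin_num by apply: prode_fin_num => k _.
pose cn := NngNum (fine_ge0 c0).
pose g x := \prod_(k | k != j) f k (X k x).
have mfX k : measurable_fun setT (fun x => f k (X k x)).
  exact: measurableT_comp.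
have mg : measurable_fun setT g.
  rewrite /g; under eq_fun do rewrite big_mkcond/=.
  by apply: measurable_prod => k _ /=; case: (k != j).
have g0 x : 0 <= g x by apply: prodr_ge0.
(* With [f j] replaced by an indicator, the induction hypothesis says that weighting by the other
   factors only multiplies the law of [X j] by the constant [c]; it then remains to integrate [f j]
   against this law. *)
have nuE B : measurable B -> mscale cn (distribution P (X j)) B =
    (\int[P]_(x in X j @^-1` B) (g x)%:E)%E.
  move=> mB; pose f' k := if k == j then \1_B else f k.
  have : (\int[P]_x (\prod_k f' k (X k x))%:E =
          \prod_k \int[P]_x (f' k (X k x))%:E)%E.
    apply: IH.
    - by move=> k; rewrite /f'; case: ifP.
    - by move=> k y; rewrite /f'; case: ifP.
    - move=> k; rewrite /f'; case: ifP => // _.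
      rewrite (_ : (fun x => _) = (fun x => (\1_(X k @^-1` B) x)%:E))//.
      rewrite integral_indic//; last exact: mXB.
      by rewrite (le_lt_trans (probability_le1 _ _)) ?ltry// setIT; exact: mXB.
    - move=> k ks; rewrite /f'; case: (eqVneq k j) => [_|kj].
        by exists B.
      by apply: fs; rewrite inE negb_or kj.
  have f'j : f' j = \1_B by rewrite /f' eqxx.
  have f'k k : k != j -> f' k = f k by rewrite /f' => /negbTE ->.
  rewrite [X in _ = X -> _](bigD1 j)//= f'j.
  under [X in (_ = _ * X)%E -> _]eq_bigr => k kj do rewrite f'k//.
  rewrite -/c [X in (_ = X * _)%E -> _](_ : _ = P (X j @^-1` B)); last first.
    by rewrite -[X j @^-1` B]setIT -integral_indic//; exact: mXB.
  move=> H; rewrite /mscale/= fineK// muleC -H [RHS]integral_mkcond.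
  apply: eq_integral => x _; rewrite (bigD1 j)//= f'j.
  under eq_bigr => k kj do rewrite f'k//.
  by rewrite -/(g x) EFinM muleC epatch_indic.
have f0' y : (0 <= (EFin \o f j) y)%E by rewrite lee_fin.
have mfE : measurable_fun setT (EFin \o f j) by exact/measurable_EFinP.
have := ge0_integral_weighted_law mg g0 (measurable_funP (X j)) nuE mfE f0'.
rewrite ge0_integral_mscale// (ge0_integral_distribution (X j) mfE f0')/=.
rewrite fineK// => H.
rewrite (bigD1 j)//= -/c muleC H; apply: eq_integral => x _.
by rewrite (bigD1 j)//= -/(g x) EFinM.
Qed.

(** * Tilted laws *)

(** A change of measure: reweighting [P] by [z] gives [Y] the law of [X]. Taking [A] to be the whole
    space shows that [z] has integral 1. *)
Definition tilted_law d d' (T : measurableType d) (T' : measurableType d')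
    (R : realType) (P : probability T R) (X Y : T -> T') (z : T -> R) :=
  forall A, measurable A ->
    (\int[P]_(w in Y @^-1` A) (z w)%:E = P (X @^-1` A))%E.

(** Rectangles are stable under intersection, so they can identify finite measures on rows. A
    generating cylinder is a rectangle with all other sides full, and a rectangle is a finite
    intersection of cylinders. *)
Lemma measurable_row_rectangles d (T : measurableType d) (N : nat) :
  @measurable _ 'rV[T]_N = <<s [set A | exists2 B : 'I_N -> set T,
    forall k, measurable (B k) &
    A = [set x : 'rV[T]_N | forall k, B k (x ord0 k)]] >>.
Proof.
apply/seteqP; split; apply: smallest_sub.
- exact: smallest_sigma_algebra.
- rewrite -bigcup_seq/= => A [k _ [Y mY <-]]; apply: sub_sigma_algebra.
  exists (fun j => if j == k then Y else setT).
    by move=> j; case: ifP.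
  rewrite setTI; apply/seteqP; split => x /=.
    by move=> Yx j; case: eqVneq => // ->.
  by move=> /(_ k); rewrite eqxx.
- exact: sigma_algebra_measurable.
- move=> A [B mB ->].
  rewrite (_ : [set x | _] =
    \bigcap_(k in [set: 'I_N]) ((fun x : 'rV[T]_N => x ord0 k) @^-1` B k)).
    apply: fin_bigcap_measurable => // k _.
    by rewrite -[X in measurable X]setTI; exact: measurable_coord.
  by apply/seteqP; split=> x /= + k; [move=> + _; apply|apply].
Qed.

(** Independence lets the tilts of the coordinates multiply. Both sides are finite measures of [A],
    so comparing them on rectangles is enough. *)
Lemma tilted_law_row d d' (T : measurableType d) (T' : measurableType d')
    (R : realType) (P : probability T R) (N : nat)
    (X : 'I_N -> {RV P >-> T'}) (h : 'I_N -> T' -> T') (z : 'I_N -> T' -> R) :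
    mutually_independent P [set: 'I_N]%SET (fun k => X k : T -> T') ->
    (forall k, measurable_fun setT (h k)) ->
    (forall k, measurable_fun setT (z k)) -> (forall k x, 0 <= z k x) ->
    (forall k, tilted_law P (X k) (h k \o X k) (z k \o X k)) ->
  tilted_law P (fun w => \row_k X k w) (fun w => \row_k h k (X k w))
    (fun w => \prod_k z k (X k w)).
Proof.
move=> indX mh mz z0 tX.
have mXr : measurable_fun setT (fun w => \row_k X k w).
  apply/measurable_fun_rowP => k.
  by under eq_fun do rewrite mxE; exact: measurable_funP.
have mYr : measurable_fun setT (fun w => \row_k h k (X k w)).
  apply/measurable_fun_rowP => k.
  by under eq_fun do rewrite mxE; exact: measurableT_comp.
have mZ : measurable_fun setT (fun w => \prod_k z k (X k w)).
  by apply: measurable_prod => k _; exact: measurableT_comp.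
have Z0 w : 0 <= \prod_k z k (X k w) by apply: prodr_ge0.
pose mX : {mfun T >-> 'rV[T']_N} :=
  HB.pack (fun w => \row_k X k w) (isMeasurableFun.Build _ _ _ _ _ mXr).
move=> A mA.
change (weighted_law P mZ Z0 mYr A = distribution P mX A).
apply/esym; apply: (measure_unique _ (fun=> setT) 
  (measurable_row_rectangles _ _)) => //.
- move=> _ _ [B mB ->] [C mC ->]; exists (fun k => B k `&` C k).
    by move=> k; exact: measurableI.
  apply/seteqP; split=> x /=; first by move=> [Bx Cx] k; split;
    [exact: Bx|exact: Cx].
  by move=> BCx; split=> k; have [] := BCx k.
- by move=> _; exists (fun=> setT) => //; apply/seteqP; split.
- by rewrite bigcup_const.
- move=> _ [B mB ->].
  (* The indicator is absorbed into the weight, so that by the tilt of coordinate [k] each factor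
     integrates to the probability that [X k] lies in [B k]. *)
  pose f k x := \1_(h k @^-1` B k) x * z k x.
  have mhB k : measurable (h k @^-1` B k).
    by rewrite -[X in measurable X]setTI; exact: mh.
  have fE k : (\int[P]_w (f k (X k w))%:E = P (X k @^-1` B k))%E.
    rewrite -tX// [RHS]integral_mkcond; apply: eq_integral => w _.
    by rewrite /f EFinM muleC epatch_indic.
  have mf k : measurable_fun setT (f k).
    by apply: measurable_funM => //; exact: measurable_indic.
  have f0 k x : 0 <= f k x by rewrite mulr_ge0.
  have fy k : (\int[P]_w (f k (X k w))%:E < +oo)%E.
    rewrite fE (le_lt_trans (probability_le1 _ _)) ?ltry//.
    by rewrite -[X in measurable X]setTI; exact: measurable_funP.
  have := mutually_independent_integral_prod indX mf f0 fy.
  under eq_bigr do rewrite fE.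
  have := indX [set: 'I_N]%SET B (subxx _) (fun k _ => mB k).
  rewrite [X in _ = X -> _](eq_bigl xpredT) => [<-|k]; last by rewrite inE.
  move=> fprod; rewrite /weighted_law/= /distribution/pushforward.
  have -> : mX @^-1` [set x | forall k, B k (x ord0 k)] =
      [set w | forall k, k \in [set: 'I_N]%SET -> B k (X k w)].
    apply/seteqP; split=> w /= Bw k.
      by move=> _; have := Bw k; rewrite mxE.
    by rewrite mxE; apply: Bw; rewrite inE.
  rewrite -fprod [RHS]integral_mkcond; apply: eq_integral => w _.
  rewrite /f big_split/= EFinM muleC epatch_indic/=; congr (_ * _%:E)%E.
  rewrite indicE; case: (boolP (w \in _)) => [|/negP wB].
    rewrite inE/= => wB; rewrite big1// => k _.
    by rewrite indicE mem_set//=; have := wB k; rewrite mxE.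
  have [k wk] : exists k, ~ B k (h k (X k w)).
    apply: contrapT => /forallNP xB; apply: wB; rewrite inE/= => k.
    by rewrite mxE; apply: contrapT => /xB.
  by rewrite (bigD1 k)//= indicE memNset// mul0r.
- by move=> k /=; rewrite (le_lt_trans (probability_le1 _ _)) ?ltry.
Qed.

(** * Translations of one-dimensional Gaussians *)

Lemma lebesgue_measureD (R : realType) (s : R) (A : set R) : measurable A ->
  pushforward lebesgue_measure ((fun x => x + s) : R -> measurableTypeR R) A =
  lebesgue_measure A.
Proof.
have ms : @measurable_fun _ _ (measurableTypeR R) (measurableTypeR R) setT
    (fun x : R => x + s) by exact: measurable_funD.
pose ps : {mfun measurableTypeR R >-> measurableTypeR R} :=
  HB.pack (fun x : measurableTypeR R => (x : R) + s : measurableTypeR R)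
    (isMeasurableFun.Build _ _ _ _ _ ms).
move=> mA.
change (pushforward lebesgue_measure ps A = lebesgue_measure A).
(* Lebesgue measure is characterized by its values on half-open intervals, whose length a
   translation preserves. *)
apply/esym/lebesgue_measure_unique => //= _ [[a b]] _ <-.
rewrite /pushforward (_ : _ @^-1` _ = `]a - s, b - s]%classic).
  rewrite !lebesgue_measure_itv/= !lte_fin ltrD2r; case: ifP => // _.
  by rewrite -!EFinD; congr EFin; ring.
by apply/seteqP; split=> x /=; rewrite !in_itv/= ltrBlDr lerBrDr.
Qed.

(* The ratio of the N(0, sigma^2) densities at x + s and at x. *)
Definition normal_tilt (R : realType) (sigma s x : R) : R :=
  expR (- (s * x / sigma ^+ 2) - s ^+ 2 / (2 * sigma ^+ 2)).

Lemma measurable_normal_tilt (R : realType) (sigma s : R) :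
  measurable_fun setT (normal_tilt sigma s).
Proof.
apply: measurableT_comp => //; apply: measurable_funB => //.
by apply: measurableT_comp => //; apply: measurable_funM.
Qed.

Lemma normal_tilt_gt0 (R : realType) (sigma s x : R) :
  0 < normal_tilt sigma s x.
Proof. exact: expR_gt0. Qed.

Lemma normal_pdfD (R : realType) (sigma s x : R) : sigma != 0 ->
  normal_pdf 0 sigma (x + s) = normal_tilt sigma s x * normal_pdf 0 sigma x.
Proof.
move=> s0; rewrite !normal_pdfE// mulrCA; congr (_ * _).
by rewrite /normal_fun /normal_tilt -expRD; congr expR; field.
Qed.

(** Written against Lebesgue measure, the left side integrates [normal_pdf 0 sigma (x + s)] over the
    [x] with [x + s] in [A]; translation invariance then removes [s]. *)
Lemma tilted_law_normal d (T : measurableType d) (R : realType)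
    (P : probability T R) (X : {RV P >-> R}) (sigma s : R) : sigma != 0 ->
    (forall B, measurable B -> P (X @^-1` B) = normal_prob 0 sigma B) ->
  tilted_law P X (fun w => X w + s) (fun w => normal_tilt sigma s (X w)).
Proof.
move=> s0 PX A mA; rewrite PX//.
have ms : measurable_fun setT (fun x : R => x + s) by exact: measurable_funD.
have mAs : measurable ((fun x : R => x + s) @^-1` A).
  by rewrite -[X in measurable X]setTI; exact: ms.
pose F := (EFin \o normal_tilt sigma s) \_ ((fun x : R => x + s) @^-1` A).
have mF : measurable_fun setT F.
  apply/(measurable_restrictT (EFin \o normal_tilt sigma s)) => //.
  apply: measurable_funTS.
   by apply/measurable_EFinP; exact: measurable_normal_tilt.
have F0 x : (0 <= F x)%E.
  by apply: erestrict_ge0 => y _; rewrite lee_fin ltW// normal_tilt_gt0.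
transitivity (\int[P]_w (F \o X) w)%E.
  rewrite integral_mkcond; apply: eq_integral => w _; rewrite /F /= !patchE.
  by congr (if _ then _ else _); rewrite !unfold_in.
rewrite -ge0_integral_distribution//.
have mpdf := measurable_normal_pdf 0 sigma.
have pdf0 x : 0 <= normal_pdf 0 sigma x by exact: normal_pdf_ge0.
(* Through the identity map, the law of [X] is Lebesgue measure weighted by the Gaussian density. *)
have mid : @measurable_fun _ _ (measurableTypeR R) R setT idfun.
  exact: measurable_id.
have := ge0_integral_weighted_law (mu := lebesgue_measure)
  (g := normal_pdf 0 sigma) mpdf pdf0 mid (nu := distribution P X) PX mF F0.
move=> ->.
pose G := (EFin \o normal_pdf 0 sigma) \_ A.
have mG : measurable_fun setT G.
  apply/(measurable_restrictT (EFin \o normal_pdf 0 sigma)) => //.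
  apply: measurable_funTS.
  exact/measurable_EFinP.
transitivity
  (\int[lebesgue_measure]_(x in [set: measurableTypeR R]) G ((x : R) + s)%R)%E.
  apply: eq_integral => x _; rewrite /F /G !patchE /=.
  rewrite (_ : (x + s \in A) = (x \in (fun x => x + s) @^-1` A)); last first.
    by rewrite !unfold_in.
  by case: ifP => _; rewrite ?mul0e// -EFinM -normal_pdfD.
rewrite /normal_prob [RHS]integral_mkcond -/G.
have ms' : @measurable_fun _ _ (measurableTypeR R) (measurableTypeR R) setT
  (fun x : R => x + s) by [].
have G0 x : (0 <= G x)%E by apply: erestrict_ge0 => y _; rewrite lee_fin.
have := @ge0_integral_pushforward _ _ _ _ _ _ ms' lebesgue_measure setT G
  measurableT mG (fun y _ => G0 y).
rewrite preimage_setT => <-.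
by apply: eq_measure_integral => B mB _; exact: lebesgue_measureD.
Qed.

(* Compare 1 + t E[Y] <= E[exp (t Y)] = exp (t^2 v) for small t > 0. *)
Lemma integral_le0_of_subgaussian d (T : measurableType d) (R : realType)
    (P : probability T R) (Y : T -> R) (v : R) :
    measurable_fun setT Y -> 0 <= v ->
    (forall t, \int[P]_w (expR (t * Y w))%:E = (expR (t ^+ 2 * v))%:E)%E ->
  P.-integrable setT (EFin \o Y) /\ (\int[P]_w (Y w)%:E <= 0)%E.
Proof.
move=> mY v0 mgf.
have iexp t : P.-integrable setT (fun w => (expR (t * Y w))%:E).
  apply/integrableP; split.
    apply/measurable_EFinP; apply: measurableT_comp => //.
    exact: measurable_funM.
  under eq_integral do rewrite /= ger0_norm ?expR_ge0//.
  by rewrite mgf ltry.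
(* Domination by [|Y| <= exp Y + exp (- Y)]. *)
have iY : P.-integrable setT (EFin \o Y).
  apply: (le_integrable measurableT _ _
    (integrableD measurableT (iexp 1) (iexp (-1)))).
    exact/measurable_EFinP.
  move=> w _ /=; rewrite lee_fin mul1r mulN1r.
  rewrite [leRHS]ger0_norm ?addr_ge0 ?expR_ge0//.
  have := expR_ge1Dx (Y w); have := expR_ge1Dx (- Y w).
  by have := expR_gt0 (Y w); have := expR_gt0 (- Y w); case: ger0P; lra.
split=> //.
have fY : (\int[P]_w (Y w)%:E)%E \is a fin_num by exact: integrable_fin_num.
rewrite -(fineK fY) lee_fin; set a := fine _; rewrite leNgt; apply/negP => a0.
have main u : 0 < u -> 1 + u * a <= expR (u ^+ 2 * v).
  move=> u0; rewrite -lee_fin -mgf EFinD EFinM fineK//.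
  have -> : (1%:E + u%:E * \int[P]_w (Y w)%:E = \int[P]_w (1 + u * Y w)%:E)%E.
    under [RHS]eq_integral do rewrite EFinD EFinM.
    rewrite integralD//=.
    - by rewrite integral_cst//= probability_setT mule1 integralZl.
    - exact: finite_measure_integrable_cst.
    - exact: integrableZl.
  apply: le_integral => //=.
  - under eq_fun do rewrite EFinD EFinM.
    apply: integrableD => //; first exact: finite_measure_integrable_cst.
    exact: integrableZl.
  - by move=> w _; rewrite lee_fin expR_ge1Dx.
(* This [u] ensures [4 u^2 v <= u a] and [4 u a <= 1], hence [(1 - u^2 v) (1 + u a) > 1]; yet
   [1 - u^2 v <= exp (- u^2 v)] together with [main] bounds that product by 1. *)
pose D := 4 * (v + 1 + a ^+ 2); pose u := a / D.
have D0 : 0 < D by rewrite /D; nra.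
have u0 : 0 < u by rewrite divr_gt0.
have := main u u0; have := expR_ge1Dx (- (u ^+ 2 * v)); rewrite expRN.
have e0 := expR_gt0 (u ^+ 2 * v).
have uD : u * D = a by rewrite /u divfK// gt_eqF.
move: e0; set E := expR _; move=> e0 h1 h2.
have h3 : (1 - u ^+ 2 * v) * E <= 1.
  by have := ler_wpM2r (ltW e0) h1; rewrite mulVf ?gt_eqF.
have uv : u * v * 4 <= a by rewrite -uD /D; nra.
have uva : u ^+ 2 * v * 4 <= u * a.
  by have := ler_wpM2l (ltW u0) uv; rewrite expr2 !mulrA.
have ua1 : u * a * 4 <= 1.
  rewrite -(ler_pM2r D0) (_ : u * a * 4 * D = (u * D) * a * 4); last by ring.
  by rewrite uD /D; nra.
have : (1 - u ^+ 2 * v) * (1 + u * a) <= 1.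
  by apply: le_trans h3; rewrite ler_pM2l//; lra.
have : 0 < u * a by rewrite mulr_gt0.
have : 0 <= u ^+ 2 * v by rewrite mulr_ge0// sqr_ge0.
by move: uva ua1; set x := u ^+ 2 * v; set y := u * a; nra.
Qed.

(** * Kullback-Leibler divergence *)

Lemma measurable_lne (R : realType) : measurable_fun setT (@lne R).
Proof.
have lneE : @lne R = fun x => if x == +oo%E then +oo%E else
    if (0 < x)%E then (ln (fine x))%:E else -oo%E.
  by apply/funext => -[r| |] //=; rewrite lte_fin ltNge; case: ifP.
rewrite lneE; apply: measurable_fun_ifT => //.
  exact: measurable_fun_eqe.
apply: measurable_fun_ifT => //.
  exact: measurable_fun_lte.
by apply/measurable_EFinP; exact: measurableT_comp.
Qed.

(** Positive and negative parts are compared separately and extended subtraction is monotone, so the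
    bound also covers the logarithm of a density, not known to be integrable. *)
Lemma le_integral_measurable d (T : measurableType d) (R : realType)
    (mu : {measure set T -> \bar R}) (f g : T -> \bar R) :
    measurable_fun setT f -> measurable_fun setT g ->
    (forall x, f x <= g x)%E ->
  (\int[mu]_x f x <= \int[mu]_x g x)%E.
Proof.
move=> mf mg fg; rewrite [leLHS]integralE [leRHS]integralE leeB//.
- apply: ge0_le_integral => //; try exact: measurable_funepos.
  by move=> x _; rewrite !funeposE ge_max !le_max fg lexx orbT.
- apply: ge0_le_integral => //; try exact: measurable_funeneg.
  by move=> x _; rewrite !funenegE ge_max !le_max leeN2 fg lexx orbT.
Qed.

Lemma integral_distributionT d d' (T : measurableType d)
    (T' : measurableType d') (R : realType) (P : probability T R)
    (X : {RV P >-> T'}) (f : T' -> \bar R) :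
    measurable_fun setT f ->
  (\int[distribution P X]_y f y = \int[P]_w f (X w))%E.
Proof.
move=> mf; rewrite integralE [RHS]integralE; congr (_ - _)%E.
- rewrite ge0_integral_distribution//; last exact: measurable_funepos.
  by rewrite -funepos_comp.
- rewrite ge0_integral_distribution//; last exact: measurable_funeneg.
  by rewrite -funeneg_comp.
Qed.

(** This is [ln t <= t - 1] at [t = x exp (- c)]; for [x <= 0] the logarithm [lne x] is [-oo]. *)
Lemma lne_le_tilt (R : realType) (x : \bar R) (c : R) : x \is a fin_num ->
  (lne x <= (c - 1)%:E + maxe x 0 * (expR (- c))%:E)%E.
Proof.
case: x => // x _; rewrite /lne; case: ifPn => x0; first by rewrite leNye.
rewrite -ltNge in x0.
have -> : maxe x%:E 0%E = x%:E by rewrite max_l// lee_fin ltW.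
rewrite lee_fin.
have := expR_ge1Dx (ln x - c); rewrite expRD lnK//; lra.
Qed.

(** With [c = Y w + v] in [lne_le_tilt], the right side integrates to at most [v]: [Y] contributes
    at most 0, the constant contributes [v - 1], and the weighted density at most 1. *)
Lemma kl_divergence_tilted d d' (T : measurableType d) (T' : measurableType d')
    (R : realType) (P : probability T R) (V V' : {RV P >-> T'}) (Y : T -> R)
    (v : R) :
    measurable_fun setT Y -> P.-integrable setT (EFin \o Y) ->
    (\int[P]_w (Y w)%:E <= 0)%E ->
    tilted_law P V' V (fun w => expR (- (Y w + v))) ->
  (kl_divergence (distribution P V) (distribution P V') <= v%:E)%E.
Proof.
move=> mY iY Y0 tV.
pose Z w := expR (- (Y w + v)).
have mZ : measurable_fun setT Z.
  apply: measurableT_comp => //; apply: measurableT_comp => //.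
  exact: measurable_funD.
have Z0 w : 0 <= Z w by exact: expR_ge0.
have mV (A : set T') : measurable A -> measurable (V @^-1` A).
  by move=> mA; rewrite -[X in measurable X]setTI; exact: measurable_funP.
(* The weight is positive, so a null set for the law of [V'] has a [P]-null preimage under [V]. *)
have dom : distribution P V `<< distribution P V'.
  apply/null_content_dominatesP => A mA PA.
  have : (\int[P]_(w in V @^-1` A) (Z w)%:E = 0)%E by rewrite tV.
  move=> ZA.
  have mZE : measurable_fun (V @^-1` A) (EFin \o Z).
    by apply: measurable_funTS; exact/measurable_EFinP.
  have [+ _] := ae_eq_integral_abs P (mV A mA) mZE.
  under eq_integral do rewrite /= ger0_norm//.
  move=> /(_ ZA) [N [mN PN sN]].
  apply: (subset_measure0 (mV A mA) mN _ PN).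
  move=> w Aw; apply: sN => /= H; have [Zw] := H Aw.
  by have := expR_gt0 (- (Y w + v)); rewrite -/(Z w) Zw ltxx.
rewrite /kl_divergence asboolT//; set f := Radon_Nikodym _ _.
have ff x : f x \is a fin_num by exact: Radon_Nikodym_fin_num.
have mf : measurable_fun setT f.
  by apply: measurable_int; exact: Radon_Nikodym_integrable.
(* As the derivative of a charge, [f] is nonnegative only almost everywhere; the truncation gives a
   pointwise sign. *)
pose fp x := maxe (f x) 0%E.
have fp0 x : (0 <= fp x)%E by rewrite le_max lexx orbT.
have mfp : measurable_fun setT fp by exact: measurable_maxe.
(* By the tilt, this is the integral of [fp] under the law of [V'], that is, the mass that the law
   of [V] gives to the set where [f >= 0]. *)
have fpZ : (\int[P]_w (fp (V w) * (Z w)%:E) <= 1)%E.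
  rewrite -(@ge0_integral_weighted_law _ _ _ _ _ P Z V mZ Z0 (measurable_funP V)
    (distribution P V') fp)//; last by move=> A mA; rewrite tV.
  have mD : measurable [set x | (0 <= f x)%E].
    by rewrite -[X in measurable X]setTI; exact: emeasurable_fun_c_infty.
  rewrite (_ : integral _ _ _ =
      \int[distribution P V']_(x in [set x | (0 <= f x)%E]) f x)%E.
    by rewrite -Radon_Nikodym_integral//=; exact: probability_le1.
  rewrite [RHS]integral_mkcond; apply: eq_integral => x _.
  rewrite patchE /fp; have [fx|fx] := leP 0%E (f x).
    by rewrite mem_set.
  by rewrite memNset//=; apply/negP; rewrite -ltNge.
rewrite integral_distributionT; last first.
  exact: measurableT_comp (@measurable_lne R) mf.
have ifp : P.-integrable setT (fun w => fp (V w) * (Z w)%:E)%E.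
  apply/integrableP; split.
    apply: emeasurable_funM; first exact: measurableT_comp.
    exact/measurable_EFinP.
  under eq_integral do rewrite gee0_abs ?mule_ge0 ?lee_fin//.
  by rewrite (le_lt_trans fpZ)// ltry.
have iYv : P.-integrable setT (fun w => (Y w + (v - 1))%:E).
  under eq_fun do rewrite EFinD.
  by apply: integrableD => //; exact: finite_measure_integrable_cst.
apply: (@le_trans _ _
    (\int[P]_w ((Y w + (v - 1))%:E + fp (V w) * (Z w)%:E))%E).
  apply: le_integral_measurable.
  - exact: (measurableT_comp (measurableT_comp (@measurable_lne R) mf)
      (measurable_funP V)).
  - exact: measurable_int (integrableD measurableT iYv ifp).
  - by move=> w; rewrite addrA; exact: lne_le_tilt.
rewrite integralD//=; under eq_integral do rewrite EFinD.
rewrite integralD//=; last exact: finite_measure_integrable_cst.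
rewrite integral_cst//= probability_setT mule1.
rewrite (_ : v%:E = 0 + (v - 1)%:E + 1)%E; last first.
  by rewrite add0e -EFinD subrK.
by apply: leeD => //; apply: leeD.
Qed.

(** * Graph Laplacian *)

Section Dot.
Variables (R : realType) (n : nat).
Implicit Types u v w : 'rV[R]_n.

Definition dot u v : R := \sum_i u ord0 i * v ord0 i.

Lemma dotE u v : dot u v = (u *m v^T) ord0 ord0.
Proof. by rewrite mxE; apply: eq_bigr => i _; rewrite mxE. Qed.

Lemma dotC u v : dot u v = dot v u.
Proof. by apply: eq_bigr => i _; rewrite mulrC. Qed.

Lemma dotDl u v w : dot (u + v) w = dot u w + dot v w.
Proof. by rewrite !dotE mulmxDl mxE. Qed.

Lemma dotZl a u w : dot (a *: u) w = a * dot u w.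
Proof. by rewrite !dotE -scalemxAl mxE. Qed.

Lemma dotDr u v w : dot w (u + v) = dot w u + dot w v.
Proof. by rewrite ![dot w _]dotC dotDl. Qed.

Lemma dotZr a u w : dot w (a *: u) = a * dot w u.
Proof. by rewrite ![dot w _]dotC dotZl. Qed.

Lemma dot_ge0 u : 0 <= dot u u.
Proof. by apply: sumr_ge0 => i _; rewrite -expr2 sqr_ge0. Qed.

Lemma dot_eq0 u : dot u u = 0 -> u = 0.
Proof.
move=> /eqP; rewrite psumr_eq0 => [/allP u0|i _]; last first.
  by rewrite -expr2 sqr_ge0.
apply/rowP => i; have := u0 i (mem_index_enum _).
by rewrite /= mulf_eq0 orbb mxE => /eqP.
Qed.

End Dot.

Section Laplacian.
Variables (R : realType) (n : nat) (e : rel 'I_n).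
Hypothesis e_sym : symmetric e.
Local Notation L := (laplacian R e).
Implicit Types u v w : 'rV[R]_n.

Lemma trmx_laplacian : L^T = L.
Proof. by rewrite /laplacian trmx_mul trmxK. Qed.

Lemma dot_laplacian u v : dot (u *m L) v = dot u (v *m L).
Proof. by rewrite !dotE trmx_mul trmx_laplacian -[u *m L *m _]mulmxA. Qed.

Lemma mulmx_incidenceE u c :
  (u *m incidence_mx R e) ord0 c =
  u ord0 (enum_val c).1 - u ord0 (enum_val c).2.
Proof.
have := enum_valP c; rewrite inE => /andP[lt12 _]; set p := enum_val c.
have p12 : p.2 != p.1 by apply: contraTneq lt12 => ->; rewrite ltnn.
rewrite mxE (bigD1 p.1)//= (bigD1 p.2)//= big1 => [|i /andP[i1 i2]].
  by rewrite !mxE /= -/p eqxx (negbTE p12) eqxx; ring.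
by rewrite mxE /= -/p (negbTE i1) (negbTE i2) mulr0.
Qed.

(** The degree-minus-adjacency form of the Laplacian. The incidence matrix lists each edge once,
    from smaller to larger end; symmetry of [e] restores both directions. *)
Lemma mulmx_laplacianE u i :
  (u *m L) ord0 i = \sum_(j | e i j) (u ord0 i - u ord0 j).
Proof.
rewrite /laplacian mulmxA mxE.
under eq_bigr do rewrite mulmx_incidenceE !mxE.
rewrite -(@big_enum_val _ _ _ _ (mem (edges e))
  (fun p => (u ord0 p.1 - u ord0 p.2) *
    (if i == p.1 then 1 else if i == p.2 then -1 else 0)))/=.
pose F (a b : 'I_n) : R := if (a < b)%N && e a b then
  (u ord0 a - u ord0 b) * ((i == a)%:R - (i == b)%:R) else 0.
transitivity (\sum_a \sum_b F a b).
  rewrite pair_bigA/= big_mkcond/=; apply: eq_bigr => -[a b] _.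
  rewrite /F inE /=; case: ifP => // /andP[ab _]; congr (_ * _).
  case: (eqVneq i a) => [->|ia]; last first.
    by case: (i == b); rewrite mulr0n sub0r ?mulr0n ?oppr0.
  rewrite (_ : a == b = false) ?subr0//.
  by apply/eqP => E; rewrite E ltnn in ab.
(* [G] collects the edges whose smaller end is [i], and [H] those whose larger end is [i]. *)
pose G (a b : 'I_n) : R := if i == a then
  (if (i < b)%N && e i b then u ord0 i - u ord0 b else 0) else 0.
pose H (a b : 'I_n) : R := if i == b then
  (if (a < i)%N && e i a then u ord0 i - u ord0 a else 0) else 0.
have FE a b : F a b = G a b + H a b.
  rewrite /F /G /H; case: (eqVneq i a) => [<-|ia];
    case: (eqVneq i b) => [<-|ib];
    rewrite ?mulr0n ?mulr1n ?ltnn ?addr0 ?add0r//=.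
    by rewrite subr0 mulr1.
    by rewrite mulrN1 opprB e_sym.
  by rewrite oppr0 mulr0; case: ifP.
have -> : \sum_a \sum_b F a b = \sum_a \sum_b G a b + \sum_a \sum_b H a b.
  rewrite -big_split/=; apply: eq_bigr => a _.
  by rewrite -big_split/=; apply: eq_bigr => b _.
have -> : \sum_a \sum_b G a b =
    \sum_(b < n) (if (i < b)%N && e i b then u ord0 i - u ord0 b else 0).
  rewrite (bigD1 i)//= [X in _ + X]big1 ?addr0 => [|a ia]; last first.
    by apply: big1 => b _; rewrite /G eq_sym (negbTE ia).
  by apply: eq_bigr => b _; rewrite /G eqxx.
have -> : \sum_a \sum_b H a b =
    \sum_(a < n) (if (a < i)%N && e i a then u ord0 i - u ord0 a else 0).
  rewrite exchange_big/= (bigD1 i)//= [X in _ + X]big1 ?addr0; last first.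
    by move=> b ib; apply: big1 => a _; rewrite /H eq_sym (negbTE ib).
  by apply: eq_bigr => a _; rewrite /H eqxx.
rewrite -big_split [RHS]big_mkcond/=; apply: eq_bigr => j _.
case: (ltngtP i j) => [ij|ji|/val_inj ->]; rewrite ?addr0 ?add0r//=.
by rewrite subrr; case: ifP.
Qed.

(** Exchanging the two sums symmetrizes the product form into squares; the half accounts for each
    edge being counted in both directions. *)
Lemma dot_laplacian_id u :
  dot (u *m L) u = 2^-1 * \sum_i \sum_(j | e i j) (u ord0 i - u ord0 j) ^+ 2.
Proof.
pose S := \sum_i \sum_(j | e i j) (u ord0 i - u ord0 j) * u ord0 i.
have -> : dot (u *m L) u = S.
  by apply: eq_bigr => i _; rewrite mulmx_laplacianE mulr_suml.
suff -> : \sum_i \sum_(j | e i j) (u ord0 i - u ord0 j) ^+ 2 = S + S.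
  by field.
rewrite {2}/S; under [X in _ = _ + X]eq_bigr do rewrite big_mkcond.
rewrite [X in _ = _ + X]exchange_big/= -big_split/=; apply: eq_bigr => i _.
rewrite -big_mkcond/= [X in _ = _ + X](eq_bigl (e i)); last first.
  by move=> j; rewrite e_sym.
by rewrite -big_split/=; apply: eq_bigr => j _; ring.
Qed.

Lemma dot_laplacian_ge0 u : 0 <= dot (u *m L) u.
Proof.
rewrite dot_laplacian_id mulr_ge0 ?invr_ge0//.
by apply: sumr_ge0 => i _; apply: sumr_ge0 => j _; exact: sqr_ge0.
Qed.

(** Constants lie in the kernel of [L], which is symmetric. *)
Lemma sum_mulmx_laplacian u : \sum_i (u *m L) ord0 i = 0.
Proof.
transitivity (dot (u *m L) (const_mx 1)).
  by apply: eq_bigr => i _; rewrite [const_mx _ _ _]mxE mulr1.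
rewrite dot_laplacian /dot big1// => i _.
rewrite mulmx_laplacianE big1 ?mulr0// => j _.
by rewrite !mxE subrr.
Qed.

Hypothesis econn : graph_connected e.

(** A vanishing sum of squares makes [u] constant along edges, hence along paths. *)
Lemma laplacian_ker_const u i j : dot (u *m L) u = 0 -> u ord0 i = u ord0 j.
Proof.
rewrite dot_laplacian_id => /eqP; rewrite mulf_eq0 invr_eq0 pnatr_eq0/=.
rewrite psumr_eq0 => [/allP u0|k _]; last first.
  by apply: sumr_ge0 => l _; exact: sqr_ge0.
have ue a b : e a b -> u ord0 a = u ord0 b.
  move=> ab; have := u0 a (mem_index_enum _).
  rewrite /= psumr_eq0 => [/allP|l _].
    move=> /(_ b (mem_index_enum _)); rewrite ab/= sqrf_eq0 subr_eq0.
    by move=> /eqP.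
  exact: sqr_ge0.
have [->//|ij] := eqVneq i j.
have /connectP[p + ->] := econn ij.
by elim: p i {ij} => //= a p IH i /andP[/ue -> /IH].
Qed.

End Laplacian.

(** * The smallest non-zero Laplacian eigenvalue *)

Section AlgebraicConnectivity.
Variables (R : realType) (n : nat) (e : rel 'I_n).
Hypotheses (e_sym : symmetric e) (econn : graph_connected e).
Local Notation L := (laplacian R e).
Implicit Types u v w : 'rV[R]_n.

Let row_sum u := \sum_i u ord0 i.

Let continuous_coord_sum (F : 'I_n -> 'rV[R]_n -> R) :
  (forall i, continuous (F i)) -> continuous (fun u => \sum_i F i u).
Proof.
move=> cF; apply: continuous_big => //.
by move=> x; exact: add_continuous.
Qed.

Let continuous_dot (A : 'M[R]_n) : continuous (fun u => dot (u *m A) u).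
Proof.
have -> : (fun u => dot (u *m A) u) =
    (fun u => \sum_i (\sum_k u ord0 k * A k i) * u ord0 i).
  by apply/funext => u; apply: eq_bigr => i _; rewrite mxE.
apply: continuous_coord_sum => i u.
have cA : continuous (fun u : 'rV[R]_n => \sum_k u ord0 k * A k i).
  apply: continuous_coord_sum => k {}u.
  by apply: continuousM; [exact: coord_continuous|exact: cst_continuous].
by apply: continuousM; [exact: cA|exact: coord_continuous].
Qed.

(** The unit sphere of the hyperplane orthogonal to the constants; there the Rayleigh quotient is
    just [dot (u *m L) u]. *)
Let K : set 'rV[R]_n := [set u | row_sum u = 0 /\ dot u u = 1].

Let compactK : compact K.
Proof.
apply: bounded_closed_compact.
  exists 1; split; first exact: num_real.
  move=> M M1 u [_ u1]; apply: le_trans (ltW M1).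
  rewrite [leLHS]/Num.norm /= mx_normrE.
  apply/bigmax_leP; split=> //= -[i j] _ /=.
  rewrite (ord1 i) -(@expr_le1 _ 2)// -normrX ger0_norm ?sqr_ge0// -u1.
  rewrite /dot (bigD1 j)//= -expr2 lerDl; apply: sumr_ge0 => k _.
  by rewrite -expr2 sqr_ge0.
(* The identity matrix puts the norm constraint in the form covered by [continuous_dot]. *)
have -> : K = (row_sum @^-1` [set 0]) `&`
    ((fun u => dot (u *m 1%:M) u) @^-1` [set 1]).
  by apply/seteqP; split=> u /=; rewrite mulmx1.
apply: closedI; apply: closed_comp; try exact: closed_eq.
- by move=> u _; apply: continuous_coord_sum => i; exact: coord_continuous.
- by move=> u _; exact: continuous_dot.
Qed.

Let scale_row_sum a u : row_sum (a *: u) = a * row_sum u.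
Proof. by rewrite /row_sum mulr_sumr; apply: eq_bigr => i _; rewrite mxE. Qed.

Let add_row_sum u v : row_sum (u + v) = row_sum u + row_sum v.
Proof. by rewrite /row_sum -big_split; apply: eq_bigr => i _; rewrite mxE. Qed.

Let normalize u : row_sum u = 0 -> u != 0 -> K ((Num.sqrt (dot u u))^-1 *: u).
Proof.
move=> u0 un; rewrite /K /= scale_row_sum u0 mulr0 dotZl dotZr; split=> //.
have du : 0 < dot u u.
  by rewrite lt0r dot_ge0 andbT; apply: contraNneq un => /dot_eq0 ->.
by rewrite mulrA -invfM -expr2 (sqr_sqrtr (dot_ge0 u)) mulVf// gt_eqF.
Qed.

Hypothesis n_gt1 : (1 < n)%N.

Let K_nonempty : K !=set0.
Proof.
pose i0 := Ordinal (ltnW n_gt1); pose i1 := Ordinal n_gt1.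
pose u : 'rV[R]_n := delta_mx ord0 i0 - delta_mx ord0 i1.
exists ((Num.sqrt (dot u u))^-1 *: u); apply: normalize.
  rewrite /row_sum (bigD1 i0)//= (bigD1 i1)//= big1 ?addr0 => [|i].
    by rewrite !mxE !eqxx /=; ring.
  by move=> /andP[/negbTE h0 /negbTE h1]; rewrite !mxE h0 h1 /= subr0.
apply/eqP => /rowP/(_ i0); rewrite !mxE eqxx /= subr0 => /eqP.
by rewrite oner_eq0.
Qed.

(* lam is the minimum of the Rayleigh quotient on the zero-sum vectors. *)
Lemma laplacian_rayleigh : exists lam, [/\ 0 < lam, eigenvalue L lam &
  forall u, \sum_i u ord0 i = 0 -> lam * dot u u <= dot (u *m L) u].
Proof.
have [u0 /set_mem[u0s u01] u0min] := EVT_min_rV K_nonempty compactK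
  (continuous_subspaceT (@continuous_dot L)).
pose lam := dot (u0 *m L) u0.
have ray u : row_sum u = 0 -> lam * dot u u <= dot (u *m L) u.
  move=> us; have [->|un] := eqVneq u 0.
    by rewrite mul0mx !dotE !mul0mx mxE mulr0.
  have du : 0 < dot u u.
    by rewrite lt0r dot_ge0 andbT; apply: contraNneq un => /dot_eq0 ->.
  have := u0min _ (mem_set (normalize us un)).
  rewrite -/lam -scalemxAl dotZl dotZr mulrA -invfM -expr2.
  rewrite (sqr_sqrtr (dot_ge0 u)).
  by rewrite [X in _ <= X -> _]mulrC ler_pdivlMr.
exists lam; split => //.
(* A zero minimum would make [u0] constant, hence zero since its entries sum to 0, against
   [dot u0 u0 = 1]. *)
- rewrite lt0r dot_laplacian_ge0// andbT; apply/eqP => l0.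
  have uc i j := laplacian_ker_const e_sym econn i j l0.
  pose i0 := Ordinal (ltnW n_gt1).
  have : row_sum u0 = u0 ord0 i0 *+ n.
    by rewrite /row_sum (eq_bigr (fun=> u0 ord0 i0)) ?sumr_const ?card_ord.
  rewrite u0s => /esym/eqP.
  rewrite mulrn_eq0 gtn_eqF ?(ltnW n_gt1)//= => /eqP h.
  move: u01; rewrite /dot big1 => [/eqP|i _]; first by rewrite eq_sym oner_eq0.
  by rewrite (uc i i0) h mul0r.
(* The residual [w] has zero sum, so [u0 + t *: w] is admissible in the Rayleigh inequality for
   every [t]; minimality to first order forces [w = 0]. *)
- have [w wE] : exists w, w = u0 *m L - lam *: u0.
    by exists (u0 *m L - lam *: u0).
  have ws : row_sum w = 0.
    by rewrite wE -scaleNr add_row_sum scale_row_sum u0s mulr0 /row_sum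
      sum_mulmx_laplacian// addr0.
  have w0 : w = 0.
    apply: dot_eq0; apply/eqP; rewrite eq_le dot_ge0 andbT leNgt.
    apply/negP => W0.
    pose q := dot (w *m L) w - lam * dot w w.
    have q0 : 0 <= q by rewrite subr_ge0 ray.
    have main t : 0 <= 2 * t * dot w w + t ^+ 2 * q.
      have : row_sum (u0 + t *: w) = 0.
        by rewrite add_row_sum scale_row_sum u0s ws mulr0 addr0.
      move=> /ray; rewrite -subr_ge0 mulmxDl -scalemxAl.
      rewrite !(dotDl, dotDr, dotZl, dotZr) -/lam u01.
      have -> : dot (w *m L) u0 = dot (u0 *m L) w by rewrite dot_laplacian dotC.
      have -> : dot w u0 = dot u0 w by rewrite dotC.
      have : dot (u0 *m L) w = dot w w + lam * dot u0 w.
        by rewrite {2}wE -scaleNr dotDl dotZl mulNr subrK.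
      rewrite /q; set a := dot (w *m L) w; set b := dot w w.
      by set c := dot (u0 *m L) w; set f := dot u0 w => -> ; lra.
    (* At [t = - D] the right side of [main] is [- D^2 (q + 2)], which is negative; the [+ 1] keeps
       the denominator positive even if [q = 0]. *)
    have := main (- (dot w w / (q + 1))).
    set b := dot w w; set D := b / (q + 1).
    have D0 : 0 < D by rewrite divr_gt0//; lra.
    have bD : D * (q + 1) = b by rewrite divfK//; lra.
    by rewrite -bD; nra.
  apply/eigenvalueP; exists u0; first by apply/eqP; rewrite -subr_eq0 -wE w0.
  apply: contra_eqN u01 => /eqP ->.
  by rewrite dotE mul0mx mxE eq_sym oner_neq0.
Qed.

Local Notation mu := (smallest_nonzero_eigenvalue L).

(** An eigenvector for a non-zero eigenvalue has zero sum, because the image of [L] does; the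
    Rayleigh inequality then places its eigenvalue above [lam]. *)
Lemma smallest_nonzero_eigenvalue_laplacian : 0 < mu /\
  forall u, \sum_i u ord0 i = 0 -> mu * dot u u <= dot (u *m L) u.
Proof.
have [lam [l0 el ray]] := laplacian_rayleigh.
have lmin nu : eigenvalue L nu -> nu != 0 -> lam <= nu.
  move=> /eigenvalueP[v vL v0] nu0.
  have vs : row_sum v = 0.
    have : nu * row_sum v = 0.
      by rewrite -scale_row_sum -vL; exact: sum_mulmx_laplacian.
    by move=> /eqP; rewrite mulf_eq0 (negbTE nu0) => /eqP.
  have := ray v vs; rewrite vL dotZl ler_pM2r//.
  by rewrite lt0r dot_ge0 andbT; apply: contraNneq v0 => /dot_eq0 ->.
suff -> : mu = lam by [].
(* [lam] meets the specification and antisymmetry makes it the only such value, so the default 0 is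
   not returned. *)
apply: xget_subset1; first by split; rewrite ?gt_eqF.
move=> a b [ea a0 amin] [eb b0 bmin].
by apply/eqP; rewrite eq_le amin ?bmin.
Qed.

(** A zero-sum vector is orthogonal to the kernel of the symmetric matrix [L], hence in its row
    space. The bound is the spectral estimate for the inverse of [L] on zero-sum vectors. *)
Lemma laplacian_solve v : \sum_i v ord0 i = 0 ->
  exists2 u, u *m L = v & dot v u <= dot v v / mu.
Proof.
move=> vs; have [mu0 ray] := smallest_nonzero_eigenvalue_laplacian.
have /submxP[u0 vE] : (v <= L)%MS.
  rewrite submxE; apply/eqP/rowP => j; rewrite [RHS]mxE.
  pose w : 'rV[R]_n := (col j (cokermx L))^T.
  have wL : w *m L = 0.
    rewrite -(trmx_laplacian R e) /w -trmx_mul; apply/eqP.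
    by rewrite trmx_eq0 colE mulmxA mulmx_coker mul0mx.
  have wc i k : w ord0 i = w ord0 k.
    by apply: (laplacian_ker_const e_sym econn); rewrite wL dotE mul0mx mxE.
  pose i0 := Ordinal (ltnW n_gt1).
  rewrite mxE (eq_bigr (fun k => v ord0 k * w ord0 i0)) => [|k _].
    by rewrite -mulr_suml vs mul0r.
  by rewrite (wc i0 k) !mxE.
(* Subtracting the mean leaves the image under [L] unchanged and makes the Rayleigh inequality
   available. *)
pose c := row_sum u0 / n%:R.
have n0 : (n%:R : R) != 0 by rewrite pnatr_eq0 gtn_eqF// ltnW.
pose u := u0 - const_mx c.
have uL : u *m L = v.
  rewrite mulmxBl -vE (_ : const_mx c *m L = 0) ?subr0//.
  apply/rowP => i; rewrite mulmx_laplacianE// [RHS]mxE big1// => j _.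
  by rewrite !mxE subrr.
have us : row_sum u = 0.
  rewrite /row_sum; under eq_bigr do rewrite !mxE.
  rewrite big_split/= sumr_const card_ord mulNrn /c -[_ *+ n]mulr_natr divfK//.
  by rewrite subrr.
clearbody u; exists u => //.
have := ray u us; rewrite uL => Q.
(* Expanding [|v - mu u|^2 >= 0] and inserting [mu |u|^2 <= <v, u>] gives [mu <v, u> <= |v|^2]. *)
have := dot_ge0 (v - mu *: u); rewrite -scaleNr !(dotDl, dotDr, dotZl, dotZr).
rewrite (dotC u v) ler_pdivlMr//; move: Q; set a := dot u u; set b := dot v u.
by set c' := dot v v; nra.
Qed.

End AlgebraicConnectivity.

(** * Translations of Gaussian vectors *)

Section GaussianShift.
Context d (Omega : measurableType d) (R : realType) (P : probability Omega R).
Variables (m N : nat) (sigma : R) (X : 'I_N -> {RV P >-> 'rV[R]_m}).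
Hypothesis sigma0 : sigma != 0.
Hypothesis gaussX : forall c, isotropic_gaussian P sigma (X c).
Hypothesis indX : mutually_independent P [set: 'I_N]%SET
  (fun c => X c : Omega -> 'rV[R]_m).
Implicit Type s : 'I_N -> 'rV[R]_m.

(** [score s] is a centred Gaussian of variance [2 * energy s], and [- (score s + energy s)] is the
    logarithm of the ratio of the densities at [X + s] and at [X]. *)
Let score s w := (\sum_c dot (s c) (X c w)) / sigma ^+ 2.
Let energy s := (\sum_c dot (s c) (s c)) / (2 * sigma ^+ 2).

Let measurable_translate (a : 'rV[R]_m) :
  measurable_fun setT (fun x : 'rV[R]_m => x + a).
Proof.
apply/measurable_fun_rowP => k; under eq_fun do rewrite mxE.
by apply: measurable_funD => //; exact: measurable_coord.
Qed.

Let tilt_row (a x : 'rV[R]_m) :=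
  \prod_k normal_tilt sigma (a ord0 k) (x ord0 k).

Let measurable_tilt_row a : measurable_fun setT (tilt_row a).
Proof.
apply: measurable_prod => k _.
exact: (measurableT_comp (@measurable_normal_tilt _ _ _) (measurable_coord k)).
Qed.

Let tilted_law_gaussian_row a c : tilted_law P (X c)
  (fun w => X c w + a) (fun w => tilt_row a (X c w)).
Proof.
have [gX iX] := gaussX c.
have mXk k : measurable_fun setT (fun w => X c w ord0 k).
  exact: (measurableT_comp (measurable_coord k)).
pose Xk k : {RV P >-> R} :=
  HB.pack (fun w => X c w ord0 k) (isMeasurableFun.Build _ _ _ _ _ (mXk k)).
have := @tilted_law_row _ _ _ _ _ _ _ Xk (fun k x => x + a ord0 k)
  (fun k => normal_tilt sigma (a ord0 k)) iX.
have -> : (fun w => \row_k Xk k w) = X c.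
  by apply/funext => w; apply/rowP => k; rewrite mxE.
have -> : (fun w => \row_k (Xk k w + a ord0 k)) = (fun w => X c w + a).
  by apply/funext => w; apply/rowP => k; rewrite !mxE.
apply.
- by move=> k; exact: measurable_funD.
- by move=> k; exact: measurable_normal_tilt.
- by move=> k x; exact/ltW/normal_tilt_gt0.
- by move=> k; apply: tilted_law_normal => // B mB; exact: gX.
Qed.

(** [tilted_law_row] serves at two levels: over the coordinates inside each vector, then over the
    independent vectors. *)
Lemma tilted_law_gaussian s :
  tilted_law P (fun w => \row_c X c w) (fun w => \row_c (X c w + s c))
    (fun w => expR (- (score s w + energy s))).
Proof.
have := @tilted_law_row _ _ _ _ _ _ _ X (fun c x => x + s c)
  (fun c => tilt_row (s c)) indX.
have -> : (fun w => \prod_c tilt_row (s c) (X c w)) =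
    (fun w => expR (- (score s w + energy s))).
  apply/funext => w; rewrite /tilt_row /normal_tilt.
  under eq_bigr do rewrite -expR_sum.
  rewrite -expR_sum; congr expR; rewrite /score /energy !mulr_suml -big_split.
  rewrite -sumrN; apply: eq_bigr => c _; rewrite /dot /= !mulr_suml -big_split.
  by rewrite -sumrN; apply: eq_bigr => k _ /=; rewrite opprD expr2.
apply.
- by move=> c; exact: measurable_translate.
- by move=> c; exact: measurable_tilt_row.
- by move=> c x; apply: prodr_ge0 => k _; exact/ltW/normal_tilt_gt0.
- by move=> c; exact: tilted_law_gaussian_row.
Qed.

(** [phi] stands for any observation of the draws: the tilt passes to preimages under [phi], so the
    energy of the shift bounds the divergence whatever is observed. *)
Lemma kl_divergence_gaussian_shift s d' (T : measurableType d')
    (phi : 'rV['rV[R]_m]_N -> T) (V V' : {RV P >-> T}) :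
    measurable_fun setT phi ->
    (forall w, V w = phi (\row_c (X c w + s c))) ->
    (forall w, V' w = phi (\row_c X c w)) ->
  (kl_divergence (distribution P V) (distribution P V') <=
   ((\sum_c dot (s c) (s c)) / (2 * sigma ^+ 2))%:E)%E.
Proof.
move=> mphi VE V'E.
have mY : measurable_fun setT (score s).
  apply: measurable_funM => //; apply: measurable_sum => c.
  apply: measurable_sum => k; apply: measurable_funM => //.
  exact: (measurableT_comp (measurable_coord k)).
have energy0 : 0 <= energy s.
  apply: divr_ge0; last by rewrite mulr_ge0// sqr_ge0.
  by apply: sumr_ge0 => c _; exact: dot_ge0.
have [iY Y0] : P.-integrable setT (EFin \o score s) /\
    (\int[P]_w (score s w)%:E <= 0)%E.
  apply: (integral_le0_of_subgaussian mY energy0) => t.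
  (* The density ratio for the shift by [- t *: s] has total mass 1, which yields the moment
     generating function [exp (t^2 energy)] of the score. *)
  have := @tilted_law_gaussian (fun c => - t *: s c) setT measurableT.
  rewrite !preimage_setT probability_setT.
  have -> : energy (fun c => - t *: s c) = t ^+ 2 * energy s.
    rewrite /energy mulrA; congr (_ / _); rewrite mulr_sumr.
    by apply: eq_bigr => c _; rewrite dotZl dotZr; ring.
  have scE w : score (fun c => - t *: s c) w = - (t * score s w).
    rewrite /score mulrA -mulNr; congr (_ / _); rewrite mulr_sumr -sumrN.
    by apply: eq_bigr => c _; rewrite dotZl mulNr.
  under eq_integral do rewrite scE opprD opprK expRD EFinM.
  rewrite ge0_integralZr//=.
  - rewrite expRN => /(congr1 (fun x => x * (expR (t ^+ 2 * energy s))%:E)%E).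
    by rewrite -muleA -EFinM mulVf ?gt_eqF ?expR_gt0// mule1 mul1e.
  - apply/measurable_EFinP; apply: measurableT_comp => //.
    exact: measurable_funM.
apply: (kl_divergence_tilted mY iY Y0) => A mA.
have -> : V @^-1` A = (fun w => \row_c (X c w + s c)) @^-1` (phi @^-1` A).
  by apply/seteqP; split=> w /=; rewrite VE.
rewrite tilted_law_gaussian.
  by congr (P _); apply/seteqP; split=> w /=; rewrite V'E.
by rewrite -[X in measurable X]setTI; exact: mphi.
Qed.

End GaussianShift.

(** * Views of the protocol *)

Definition extend_enum (I : finType) (D : {set I}) (T : Type) (x0 : T)
    (u : 'I_#|D| -> T) (i : I) : T :=
  if [pick a | enum_val a == i] is Some a then u a else x0.

Lemma extend_enumE (I : finType) (D : {set I}) (T : Type) (x0 : T)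
    (u : 'I_#|D| -> T) a :
  extend_enum x0 u (enum_val a) = u a.
Proof.
rewrite /extend_enum; case: pickP => [b /eqP/enum_val_inj -> //|/(_ a)].
by rewrite eqxx.
Qed.

(** Numbering the arcs lets the draws form a row vector, as the Gaussian lemmas expect. *)
Lemma mutually_independent_enum_val d d' (T : measurableType d)
    (T' : measurableType d') (R : realType) (P : probability T R) (I : finType)
    (D : {set I}) (X : I -> T -> T') :
    mutually_independent P D X ->
  mutually_independent P [set: 'I_#|D|]%SET (fun c => X (enum_val c)).
Proof.
move=> indX J B _ mB; pose B' := extend_enum setT B.
have B'E c : B' (enum_val c) = B c by rewrite /B' extend_enumE.
have := indX [set enum_val c | c in J]%SET B'.
rewrite big_imset/=; last by move=> a b _ _; exact: enum_val_inj.
under [X in _ -> _ -> _ = X]eq_bigr do rewrite B'E.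
move=> <-.
- congr (P _); apply/seteqP; split=> w /= Bw.
    by move=> _ /imsetP[c cJ ->]; rewrite B'E; exact: Bw.
  by move=> c cJ; rewrite -B'E; apply: Bw; exact: imset_f.
- by apply/fintype.subsetP => _ /imsetP[c _ ->]; exact: enum_valP.
- by move=> _ /imsetP[c cJ ->]; rewrite B'E; exact: mB.
Qed.

(** The draws seen by [C] do not change since [S] vanishes on them, and the change of the masks
    compensates [alpha - alpha']. The two probability spaces may differ, so that a view can be
    transported to the space of draws. *)
Lemma view_shift (R : realType) d d' (Omega : measurableType d)
    (Omega' : measurableType d') (P : probability Omega R)
    (P' : probability Omega' R) (n m : nat) (e : rel 'I_n)
    (r : 'I_n -> 'I_n -> {RV P >-> 'rV[R]_m})
    (r' : 'I_n -> 'I_n -> {RV P' >-> 'rV[R]_m}) (C : {set 'I_n})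
    (alpha alpha' : 'I_n -> 'rV[R]_m) (S : 'I_n -> 'I_n -> 'rV[R]_m) w w' :
    symmetric e ->
    (forall i j, e i j -> r' i j w' = r i j w + S i j) ->
    (forall i j, e i j -> (i \in C) || (j \in C) -> S i j = 0) ->
    (forall i, alpha i = alpha' i + \sum_(j | e i j) (S j i - S i j)) ->
  view e r C alpha w = view e r' C alpha' w'.
Proof.
move=> e_sym r'E S0 alphaE; rewrite /view; congr (_, _, _).
- apply: eq_from_tnth => c; rewrite !tnth_mktuple alphaE big1 ?addr0// => j ej.
  have cC := enum_valP c.
  by rewrite !S0 ?subrr ?cC ?orbT// e_sym.
- apply: eq_from_tnth => c; rewrite !tnth_mktuple.
  have := enum_valP c; rewrite !inE => /andP[ec cC].
  by rewrite r'E// S0// addr0.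
- apply: eq_from_tnth => i; rewrite !tnth_mktuple /effective_coef alphaE -addrA.
  congr (_ + _); rewrite /mask -big_split; apply: eq_bigr => j ij /=.
  rewrite (r'E i j)// (r'E j i) 1?e_sym// opprD.
  by rewrite [RHS]addrACA addrC.
Qed.

Lemma kl_divergence_view (R : realType) d (Omega : measurableType d)
    (P : probability Omega R) (n m : nat) (e : rel 'I_n) (sigma : R)
    (r : 'I_n -> 'I_n -> {RV P >-> 'rV[R]_m}) (C : {set 'I_n})
    (alpha alpha' : 'I_n -> 'rV[R]_m) (S : 'I_n -> 'I_n -> 'rV[R]_m) :
    symmetric e -> sigma != 0 -> protocol_draws e r sigma ->
    (forall i j, e i j -> (i \in C) || (j \in C) -> S i j = 0) ->
    (forall i, alpha i = alpha' i + \sum_(j | e i j) (S j i - S i j)) ->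
  (kl_divergence (distribution P (view e r C alpha))
                 (distribution P (view e r C alpha')) <=
   ((\sum_i \sum_(j | e i j) dot (S i j) (S i j)) / (2 * sigma ^+ 2))%:E)%E.
Proof.
move=> e_sym sigma0 [gr ir] S0 alphaE.
pose X (c : 'I_#|arcs e|) := r (enum_val c).1 (enum_val c).2.
pose s (c : 'I_#|arcs e|) := S (enum_val c).1 (enum_val c).2.
have mrho : measurable_fun setT (fun w => \row_c X c w).
  apply/measurable_fun_rowP => c.
  by under eq_fun do rewrite mxE; exact: measurable_funP.
pose rho : {RV P >-> 'rV['rV[R]_m]_#|arcs e|} :=
  HB.pack (fun w => \row_c X c w) (isMeasurableFun.Build _ _ _ _ _ mrho).
pose coordT i j (x : 'rV['rV[R]_m]_#|arcs e|) : 'rV[R]_m :=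
  extend_enum 0 (fun c : 'I_#|arcs e| => x ord0 c) (i, j).
have mcoordT i j : measurable_fun setT (coordT i j).
  rewrite /coordT /extend_enum; case: pickP => [c _|_] //.
  exact: measurable_coord.
(* The coordinate maps on the space of draws, equal to 0 off the arcs. Their view plays the role of
   [phi], its measurability coming from the instance on [view]. *)
pose rT i j : {RV (distribution P rho) >-> 'rV[R]_m} :=
  HB.pack (coordT i j) (isMeasurableFun.Build _ _ _ _ _ (mcoordT i j)).
have rTE i j (F : 'I_n -> 'I_n -> 'rV[R]_m) : e i j ->
    rT i j (\row_(c < #|arcs e|) F (enum_val c).1 (enum_val c).2) = F i j.
  move=> ij; have ijA : (i, j) \in arcs e by rewrite inE.
  rewrite /= /coordT -[(i, j)](enum_rankK_in ijA ijA) extend_enumE mxE.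
  by rewrite enum_rankK_in.
have -> : \sum_i \sum_(j | e i j) dot (S i j) (S i j) =
    \sum_c dot (s c) (s c).
  rewrite pair_big_dep/= /s.
  rewrite -(big_enum_val (fun p => dot (S p.1 p.2) (S p.1 p.2)))/=.
  by apply: eq_bigl => -[i j]; rewrite inE.
apply: (@kl_divergence_gaussian_shift _ _ _ _ _ _ _ X sigma0 _ _ s _ _
  (view e rT C alpha')).
- by move=> c; apply: gr; have := enum_valP c; rewrite inE.
- exact: mutually_independent_enum_val ir.
- exact: measurable_funP.
- move=> w; apply: (view_shift (S := S)) => // i j ij.
  by rewrite (rTE _ _ (fun i j => r i j w + S i j)).
(* The zero shift only transports the view of [alpha'] to the space of draws. *)
- move=> w; apply: (view_shift (S := fun _ _ => 0)) => //.
    by move=> i j ij; rewrite (rTE _ _ (fun i j => r i j w))// addr0.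
  by move=> i; rewrite big1 ?addr0// => j _; rewrite subrr.
Qed.

(** For the degenerate case of at most one honest agent, whose coefficient is fixed by the equality
    of sums. *)
Lemma eq_of_card_le1_sum (I : finType) (V : zmodType) (H : {set I})
    (f g : I -> V) : (#|H| <= 1)%N ->
    \sum_(i in H) f i = \sum_(i in H) g i ->
  forall i, i \in H -> f i = g i.
Proof.
move=> /card_le1_eqP H1 + i iH; rewrite (bigD1 i)//= [RHS](bigD1 i)//=.
by rewrite !big1 ?addr0// => j /andP[jH /eqP ji]; case: ji; exact: H1.
Qed.

(** * Shifts supported on the honest subgraph *)

Lemma sum_induced (V : nmodType) (n : nat) (e : rel 'I_n) (H : {set 'I_n})
    (F : 'I_n -> 'I_n -> V) :
  \sum_i \sum_(j | e i j) (if (i \in H) && (j \in H) then F i j else 0) =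
  \sum_a \sum_(b | induced_graph e H a b) F (enum_val a) (enum_val b).
Proof.
rewrite -(big_enum_val (A := mem H) (fun i =>
  \sum_(b | e i (enum_val b)) F i (enum_val (b : 'I_#|H|)))).
rewrite [RHS]big_mkcond/=; apply: eq_bigr => i _.
case: ifP => iH /=; last by rewrite big1.
rewrite -(big_enum_val_cond (A := mem H) (fun j => e i j) (F i)).
rewrite -big_mkcondr/=; apply: eq_bigl => j; exact: andbC.
Qed.

Lemma affine_distE (R : realType) (n m : nat)
    (alpha alpha' : 'I_n -> 'rV[R]_m) :
  affine_dist alpha alpha' ^+ 2 =
  \sum_(k < m) \sum_i (alpha i ord0 k - alpha' i ord0 k) ^+ 2.
Proof.
rewrite /affine_dist sqr_sqrtr; last by apply: sumr_ge0 => k _; exact: sqr_ge0.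
apply: eq_bigr => k _; rewrite sqr_sqrtr.
  by apply: eq_bigr => i _; rewrite !mxE.
by apply: sumr_ge0 => i _; exact: sqr_ge0.
Qed.

(** In each coordinate a potential [u k] solves the Laplacian equation for [delta], and the shift is
    half its gradient along honest edges. Summed over arcs, the squares give [dot (v k) (u k) / 2],
    whence the 2 beside the eigenvalue. *)
Lemma honest_shift (R : realType) (n m : nat) (e : rel 'I_n) (H : {set 'I_n})
    (delta : 'I_n -> 'rV[R]_m) :
    symmetric e -> graph_connected (induced_graph e H) -> (1 < #|H|)%N ->
    (forall i, i \notin H -> delta i = 0) -> \sum_(i in H) delta i = 0 ->
  exists S : 'I_n -> 'I_n -> 'rV[R]_m,
  [/\ forall i j, ~~ ((i \in H) && (j \in H)) -> S i j = 0,
      forall i, delta i = \sum_(j | e i j) (S j i - S i j) &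
      \sum_i \sum_(j | e i j) dot (S i j) (S i j) <=
      (\sum_(k < m) \sum_i delta i ord0 k ^+ 2) /
      (2 * smallest_nonzero_eigenvalue (laplacian R (induced_graph e H)))].
Proof.
move=> e_sym econn H_gt1 delta0 sum_delta.
set E := induced_graph e H; set mu := smallest_nonzero_eigenvalue _.
have E_sym : symmetric E by move=> a b; exact: e_sym.
pose v (k : 'I_m) : 'rV[R]_#|H| := \row_a delta (enum_val a) ord0 k.
have vs k : \sum_a v k ord0 a = 0.
  transitivity ((\sum_(i in H) delta i) ord0 k); last by rewrite sum_delta mxE.
  rewrite summxE (big_enum_val (fun i => delta i ord0 k)).
  by apply: eq_bigr => a _; rewrite mxE.
have /choice[u uP] : forall k, exists u,
    u *m laplacian R E = v k /\ dot (v k) u <= dot (v k) (v k) / mu.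
  move=> k; have [u uL Q] := laplacian_solve E_sym econn H_gt1 (vs k).
  by exists u.
pose U := extend_enum 0 (fun a => \row_k u k ord0 a).
have UE a k : U (enum_val a) ord0 k = u k ord0 a by rewrite /U extend_enumE mxE.
(* Sharing [U j - U i] between the two directions of an edge halves the energy that a one-way shift
   would cost. *)
pose S i j := if (i \in H) && (j \in H) then 2^-1 *: (U j - U i) else 0.
exists S; split.
- by move=> i j /negbTE ij; rewrite /S ij.
- move=> i; have [iH|iH] := boolP (i \in H); last first.
    by rewrite delta0// big1// => j _; rewrite /S (negbTE iH) andbF subrr.
  have -> : \sum_(j | e i j) (S j i - S i j) =
      \sum_(b | e i (enum_val b)) (U i - U (enum_val (b : 'I_#|H|))).
    rewrite -(big_enum_val_cond (A := mem H) (fun j => e i j)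
      (fun j => U i - U j)).
    rewrite big_andbC big_mkcondr/=; apply: eq_bigr => j _; rewrite /S iH andbT.
    case: ifP => _; last by rewrite subrr.
    by apply/rowP => k; rewrite !mxE; field.
  apply/rowP => k; rewrite summxE.
  have [uL _] := uP k.
  have /matrixP/(_ ord0 (enum_rank_in iH i)) := uL.
  rewrite mulmx_laplacianE// mxE enum_rankK_in// => <-.
  apply: eq_big => [b|b _]; first by rewrite /E /induced_graph enum_rankK_in.
  by rewrite !mxE -!UE enum_rankK_in.
- have -> : \sum_i \sum_(j | e i j) dot (S i j) (S i j) =
      \sum_k 2^-1 * dot (v k) (u k).
    transitivity (\sum_i \sum_(j | e i j) (if (i \in H) && (j \in H) then
        dot (2^-1 *: (U j - U i)) (2^-1 *: (U j - U i)) else 0)).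
      apply: eq_bigr => i _; apply: eq_bigr => j _.
      rewrite /S; case: ifP => // _.
      by rewrite dotE mul0mx mxE.
    rewrite sum_induced -/E.
    under [RHS]eq_bigr => k _.
      have [<- _] := uP k; rewrite dot_laplacian_id// mulrA mulr_sumr; over.
    rewrite [RHS]exchange_big/=; apply: eq_bigr => a _.
    under [RHS]eq_bigr do rewrite mulr_sumr.
    rewrite [RHS]exchange_big/=; apply: eq_bigr => b _.
    by apply: eq_bigr => k _; rewrite !mxE !UE; field.
  rewrite invfM mulrCA -mulr_sumr ler_pM2l ?invr_gt0// mulr_suml.
  apply: ler_sum => k _; have [_] := uP k; move=> /le_trans; apply.
  have [mu0 _] := smallest_nonzero_eigenvalue_laplacian R E_sym econn H_gt1.
  rewrite ler_pM2r ?invr_gt0// /dot.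
  rewrite (eq_bigr (fun a => delta (enum_val a) ord0 k ^+ 2)); last first.
    by move=> a _; rewrite mxE expr2.
  rewrite -(big_enum_val (fun i => delta i ord0 k ^+ 2))/= big_mkcond/=.
  by apply: ler_sum => i _; case: ifP => // _; exact: sqr_ge0.
Qed.

Theorem theorem2 (R : realType) (d : measure_display)
    (Omega : measurableType d) (P : probability Omega R)
    (n m : nat) (e : rel 'I_n) (sigma : R)
    (r : 'I_n -> 'I_n -> {RV P >-> 'rV[R]_m})
    (C : {set 'I_n}) (eps : R) :
  symmetric e -> irreflexive e -> graph_connected e ->
  (1 <= m)%N -> 0 < sigma ->
  protocol_draws e r sigma ->
  ~ vertex_cut e C ->
  ((1 < #|(~: C)%SET|)%N ->
     eps = 1 / (4 * sigma ^+ 2 * smallest_nonzero_eigenvalue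
                  (laplacian R (induced_graph e (~: C)%SET)))) ->
  ((#|(~: C)%SET| <= 1)%N -> 0 < eps) ->
  affine_private e r C eps.
Proof.
(* [vertex_cut] is a negation, so [contrapT] yields connectedness of the honest subgraph. *)
move=> e_sym _ _ _ sigma_gt0 draws /contrapT econn epsE eps_gt0.
have sigma0 : sigma != 0 by rewrite gt_eqF.
(* With at most one honest agent, [alpha] and [alpha'] agree everywhere and the zero shift bounds
   the divergence by 0. *)
have [H_gt1|H_le1] := ltnP 1 #|(~: C)%SET|; last first.
  split=> [|alpha alpha' alphaC alphaH]; first exact: eps_gt0.
  have alphaE i : alpha i = alpha' i.
    have [/alphaC//|iC] := boolP (i \in C).
    by apply: (eq_of_card_le1_sum H_le1 alphaH); rewrite inE.
  apply: le_trans
    (kl_divergence_view (S := fun _ _ => 0) e_sym sigma0 draws _ _) _ => //.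
    by move=> i; rewrite big1 ?addr0// => j _; rewrite subrr.
  rewrite big1; last first.
    by move=> i _; rewrite big1// => j _; rewrite dotE mul0mx mxE.
  by rewrite mul0r lee_fin mulr_ge0 ?sqr_ge0// ltW// eps_gt0.
set mu := smallest_nonzero_eigenvalue _ in epsE.
have E_sym : symmetric (induced_graph e (~: C)%SET) by move=> a b; exact: e_sym.
have [mu0 _] := smallest_nonzero_eigenvalue_laplacian R E_sym econn H_gt1.
rewrite -/mu in mu0; split=> [|alpha alpha' alphaC alphaH].
  by rewrite epsE// divr_gt0// mulr_gt0// mulr_gt0// exprn_gt0.
have [||S [S0 deltaE Sle]] :=
  honest_shift (delta := fun i => alpha i - alpha' i) e_sym econn H_gt1.
- by move=> i; rewrite inE negbK => /alphaC ->; rewrite subrr.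
- by rewrite sumrB alphaH subrr.
apply: le_trans (kl_divergence_view (S := S) e_sym sigma0 draws _ _) _.
- by move=> i j _ ijC; apply: S0; rewrite !inE -negb_or negbK.
- by move=> i; rewrite -deltaE addrC subrK.
(* The 2 in [Sle] and the 2 in the Gaussian bound multiply to the 4 of [eps], so the last comparison
   is an equality. *)
rewrite lee_fin ler_pdivrMr ?mulr_gt0 ?exprn_gt0//; apply: le_trans Sle _.
rewrite affine_distE epsE//.
under eq_bigr do under eq_bigr do rewrite !mxE.
set D := \sum_k _; rewrite -/mu le_eqVlt; apply/orP; left; apply/eqP.
by field; rewrite sigma0 gt_eqF.
Qed.
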